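(* Let $n>2$ and let $T$ be a connected, labeled directed tree with $n$ colors (so each vertex has a label which is an unordered pair $\{i,j\}$, where $1\leq i,j\leq n$, with $i=j$ allowed). Let $m_{i,j}$ denote the number of vertices of $T$ with label $\{i,j\}$. Call a vertex marked if its label $\{i,j\}$ has $i\neq j$. Then $T$ is an intersection graph for a connected chord diagram on $n$ components (i.e. $T$ is isomorphic, as a labeled directed graph, to $\Gamma(D)$ for some connected chord diagram $D$ with $n$ components) if and only if the following conditions are met, possibly after relabeling the tree by a permutation of the colors $1,\dots,n$: (1) The labels of adjacent vertices have at least one color in common. (2) $T$ is semisymmetric: for every vertex $v$ with a label of the form $\{i,i\}$ and any other vertex $w$, there is a directed edge from $v$ to $w$ if and only if there is a directed edge from $w$ to $v$. (3) If $v$ has label $\{i,j\}$ and $w$ has label $\{i,k\}$, where $i$, $j$ and $k$ are all distinct, then there is a directed edge between $v$ and $w$. (4) $m_{i,j}=0$ if $|i-j|>1$. (5) $m_{i,i+1}=1$ for $2\leq i\leq n-2$, $m_{1,2}\geq 1$ and $m_{n-1,n}\geq 1$. (6) No two marked vertices are connected by a path of undirected edges.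
   Context: Chord diagrams. A chord diagram of degree $d$ with $n$ components is a disjoint union of $n$ oriented line segments (the components, labeled $1,\dots,n$), together with $d$ chords (unoriented line segments whose two endpoints lie on the components), such that all $2d$ endpoints of chords are distinct. The diagram is determined by the (linear) orders of the endpoints along each component, together with the pairing of endpoints into chords. The two endpoints of a chord may lie on the same component or on different components. A chord diagram is connected if its components cannot be separated into two nonempty sets such that every chord has its endpoints on components in the same set. Intersection graphs. The intersection graph $\Gamma(D)$ of a chord diagram $D$ is the labeled directed multigraph with one vertex for each chord of $D$; the vertex of a chord is labeled by the unordered pair $\{i,j\}$ ($i=j$ allowed) of the labels of the components on which the endpoints of the chord lie. For distinct vertices $v_1,v_2$ there is a directed edge from $v_1$ to $v_2$ for each pair $(e_1,e_2)$ such that $e_1$ is an endpoint of the chord of $v_1$, $e_2$ is an endpoint of the chord of $v_2$, $e_1$ and $e_2$ lie on the same component, and the orientation of that component runs from $e_1$ to $e_2$. Edges are counted mod 2: two directed edges with the same direction between the same two vertices cancel, so at most one directed edge in each direction remains between two vertices. If two vertices are joined by a directed edge in each direction, this is regarded as a single undirected edge joining them. Trees. A directed graph (in which a pair of opposite directed edges between two vertices is regarded as a single undirected edge) is called a tree if it is a finite graph that is connected and has no cycles when the orientations of the edges are ignored. Two vertices are adjacent if they are joined by an edge, directed or undirected. A path of undirected edges is a path each of whose edges is undirected, i.e. a pair of opposite directed edges. *)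

(* Defs.v *)
(* Plain MathComp.  Colors and components 1, ..., n are encoded by 'I_n,
   i.e. by 0, ..., n-1. *)
From mathcomp Require Import all_boot all_fingroup.

Set Implicit Arguments.
Unset Strict Implicit.
Unset Printing Implicit Defensive.

(* The chords are 'I_d, and (c, false), (c, true) are the two endpoints of the
   chord c; nothing below depends on which of them is called false.
   [before e f] holds when e and f lie on the same component and the
   orientation of that component runs from e to f. *)
Record chord_diagram (d n : nat) := ChordDiagram {
  comp : 'I_d * bool -> 'I_n;
  before : rel ('I_d * bool);
  before_comp : forall e f, before e f -> comp e = comp f;
  before_irr : irreflexive before;
  before_trans : transitive before;
  before_total : forall e f, comp e = comp f -> e != f ->
    before e f || before f e }.

Definition connected_diagram (d n : nat) (D : chord_diagram d n) : Prop :=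
  forall A : {set 'I_n}, A != set0 -> ~: A != set0 ->
  ~ (forall c : 'I_d, (comp D (c, false) \in A) = (comp D (c, true) \in A)).

(* The unordered pair {i, j}, with i = j allowed, is the set [set i; j].
   A pair of opposite directed edges is an undirected edge. *)
Record ldigraph (n : nat) := LDigraph {
  vertex :> finType;
  edge : rel vertex;
  label : vertex -> {set 'I_n};
  labelP : forall v, exists i j : 'I_n, label v = [set i; j] }.

Section IntersectionGraph.
Variables (d n : nat) (D : chord_diagram d n).

(* Parity of the number of pairs of endpoints: edges are counted mod 2. *)
Definition ig_edge : rel 'I_d := fun v w =>
  (v != w) && odd #|[set p : bool * bool | before D (v, p.1) (w, p.2)]|.

Definition ig_label (v : 'I_d) : {set 'I_n} :=
  [set comp D (v, false); comp D (v, true)].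

Lemma ig_labelP (v : 'I_d) : exists i j : 'I_n, ig_label v = [set i; j].
Proof. by exists (comp D (v, false)), (comp D (v, true)). Qed.

Definition intersection_graph : ldigraph n :=
  @LDigraph n 'I_d ig_edge ig_label ig_labelP.

End IntersectionGraph.

Definition ldigraph_iso (n : nat) (G H : ldigraph n) : Prop :=
  exists f : G -> H,
    [/\ bijective f,
        forall x y : G, edge (f x) (f y) = edge x y
      & forall x : G, label (f x) = label x].

Section Graphs.
Variables (n : nat) (G : ldigraph n).

Definition adjacent : rel G := fun v w => edge v w || edge w v.

Definition undirected_edge : rel G := fun v w => edge v w && edge w v.

(* Cycles of length 1 are excluded by irreflexivity; cycles of length 2 of
   [adjacent] only run back and forth along one edge and do not count. *)
Definition is_tree : Prop :=
  [/\ irreflexive (@edge n G),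
      forall v w : G, connect adjacent v w
    & forall c : seq G, 2 < size c -> ~ ucycle adjacent c].

Definition label_mult (i j : 'I_n) : nat :=
  #|[set v : G | label v == [set i; j]]|.

Definition marked (v : G) : Prop :=
  exists i j : 'I_n, i != j /\ label v = [set i; j].

Definition semisymmetric : Prop :=
  forall (v : G) (i : 'I_n), label v = [set i; i] ->
  forall w : G, w != v -> (edge v w <-> edge w v).

Lemma relabelP (s : 'S_n) (v : G) :
  exists i j : 'I_n, s @: label v = [set i; j].
Proof.
by have [i [j ->]] := labelP v; exists (s i), (s j); rewrite imsetU !imset_set1.
Qed.

Definition relabel (s : 'S_n) : ldigraph n :=
  @LDigraph n G (@edge n G) (fun v => s @: label v) (relabelP s).

End Graphs.

(* Main.v *)
(* Necessity: an ordered pair of ends on a common component runs one way or the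
   other, so exactly one of v -> w and w -> v is an edge when the chords v and w
   have an odd number of such pairs, and both or neither otherwise.
   A component attached to three others, or a cycle of components, would give a
   cycle of chords in T, so the components form a path, and listing them along
   it gives the relabeling. An undirected path
   between two marked vertices closes up to a cycle, possibly through a third
   marked vertex adjacent to both ends.
   Sufficiency: build the diagram chord by chord, growing a connected set of
   vertices from a marked one, so that each new vertex u is adjacent to exactly
   one vertex p of the set. If u is unmarked, put its two ends immediately
   around an end of p. If u is marked then so is p by (6), and the edge between
   them is one-way; putting both ends of u before all the others (if u -> p) or
   after all the others (if p -> u) works, because u has an odd number of pairs
   of ends in common only with p. *)
Require Import Defs.
From mathcomp Require Import all_boot all_fingroup.
From mathcomp Require Import zify.

Set Implicit Arguments.
Unset Strict Implicit.
Unset Printing Implicit Defensive.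

(** * Cycles in trees, and growing a tree vertex by vertex *)

Lemma adjacent_sym (n : nat) (G : ldigraph n) : symmetric (@adjacent n G).
Proof. by move=> v w; rewrite /adjacent orbC. Qed.

Lemma tree_adjacent_neq (n : nat) (G : ldigraph n) (v w : G) :
  is_tree G -> adjacent v w -> v != w.
Proof.
by case=> irr _ _; apply: contraTneq => ->; rewrite /adjacent irr.
Qed.

Lemma tree_path_closed (n : nat) (G : ldigraph n) (v : G) (p : seq G) :
  is_tree G -> path (@adjacent n G) v p -> uniq (v :: p) -> 1 < size p ->
  ~~ adjacent (last v p) v.
Proof.
case=> _ _ acyc vp uvp p_gt1; apply/negP=> lv.
by apply: (acyc (v :: p)) => //=; rewrite /ucycle /= rcons_path vp lv.
Qed.

Lemma tree_path_apex (n : nat) (G : ldigraph n) (v c : G) (p : seq G) :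
  is_tree G -> path (@adjacent n G) v p -> uniq (v :: p) -> 0 < size p ->
  c \notin v :: p -> adjacent c v -> ~~ adjacent (last v p) c.
Proof.
move=> hG vp uvp p_gt0 cvp cv.
apply: (@tree_path_closed _ _ c (v :: p)) => //; first by rewrite /= cv.
by rewrite cons_uniq cvp.
Qed.

Lemma tree_triangle (n : nat) (G : ldigraph n) (x y z : G) :
  is_tree G -> adjacent x y -> adjacent y z -> ~~ adjacent z x.
Proof.
move=> hG xy yz; apply/negP => zx.
have [xDy yDz zDx] : [/\ x != y, y != z & z != x].
  by rewrite !(tree_adjacent_neq hG).
apply: (negP (@tree_path_closed _ _ x [:: y; z] hG _ _ _)) => //=.
  by rewrite xy yz.
by rewrite !inE !negb_or xDy yDz eq_sym zDx.
Qed.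

(** A connected vertex set can be enlarged across any edge leaving it, and acyclicity leaves the new
    vertex only one neighbor in the set. The proof carries connectedness of the subgraph induced on
    [S] along the induction. *)
Lemma tree_ind (n : nat) (G : ldigraph n) (P : {set G} -> Prop) (r : G) :
  is_tree G -> P [set r] ->
  (forall (S : {set G}) (u p : G), P S -> u \notin S -> p \in S ->
     adjacent u p -> (forall w, w \in S -> adjacent u w -> w = p) ->
     P (u |: S)) ->
  P setT.
Proof.
move=> hG Pr PU.
pose e (S : {set G}) : rel G := fun a b => [&& adjacent a b, a \in S & b \in S].
have esym S : symmetric (e S).
  by move=> a b; rewrite /e adjacent_sym [(a \in S) && _]andbC.
suff grow k (S : {set G}) : #|~: S| <= k -> r \in S -> P S ->
    (forall x y, x \in S -> y \in S -> connect (e S) x y) -> P setT.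
  apply: (grow _ _ (leqnn _) (set11 r) Pr) => x y.
  by rewrite !inE => /eqP-> /eqP->; apply: connect0.
elim: k S => [|k IHk] S Sk rS PS connS.
  suff <- : S = setT by [].
  by apply/eqP; rewrite -subTset -setCS setCT subset0 -cards_eq0 -leqn0.
have [/eqP ST|/set0Pn[z]] := boolP (~: S == set0).
  by rewrite -(setCK S) ST setC0 in PS.
rewrite inE => zS.
(* A walk from [r] to a vertex outside [S] has a first edge that leaves [S]. *)
have [u [p [uS pS up]]] :
    exists u p, [/\ u \notin S, p \in S & adjacent u p].
  have [_ /(_ r z) /connectP[q]] := hG.
  elim: q r {Pr IHk} rS => [|y q IHq] x xS /=; first by move=> _ zx; rewrite zx xS in zS.
  case/andP=> xy yq zE; have [yS|yS] := boolP (y \in S); first exact: IHq yS yq zE.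
  by exists y, x; rewrite adjacent_sym.
(* With a second neighbor [w], a simple path inside [S] from [w] to [p] would be closed into a cycle
   by [u]. *)
have uniq_p w : w \in S -> adjacent u w -> w = p.
  move=> wS uw; apply/eqP/negPn/negP => wDp.
  have /connectP[q0 q0P] := connS _ _ wS pS.
  case/shortenP: q0P => q qP uq _ pE.
  have qS : {subset q <= S}.
    elim: q w qP {uq pE wS uw wDp q0} => //= y q IHq w /andP[/and3P[_ _ yS]] yq x.
    by rewrite inE => /predU1P[->//|]; apply: IHq yq x.
  apply: (negP (@tree_path_apex _ _ w u q hG _ uq _ _ uw)).
  - by apply: sub_path qP => a b /and3P[].
  - by case: q pE {qP uq qS} => // pE; rewrite pE eqxx in wDp.
  - rewrite inE negb_or; apply/andP; split; first by apply: contraNneq uS => ->.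
    by apply: contra uS => /qS.
  - by rewrite -pE adjacent_sym.
have sub_e x y : connect (e S) x y -> connect (e (u |: S)) x y.
  apply: connect_sub => a b /and3P[ab aS bS].
  by apply: connect1; rewrite /e ab !inE aS bS !orbT.
have cu : connect (e (u |: S)) u p.
  by apply: connect1; rewrite /e up !inE eqxx pS orbT.
apply: (IHk (u |: S)).
- by have := cardsC S; have := cardsC (u |: S); rewrite cardsU1 uS; lia.
- by rewrite !inE rS orbT.
- exact: PU up uniq_p.
- have to_p x : x \in u |: S -> connect (e (u |: S)) x p.
    rewrite !inE => /predU1P[->//|xS]; apply: sub_e; exact: connS.
  move=> x y /to_p xp /to_p yp; apply: connect_trans xp _.
  by rewrite (sym_connect_sym (esym _)).
Qed.

(** * Conditions on colors, and undirected paths between marked vertices *)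

Definition shares_color (n : nat) (G : ldigraph n) : Prop :=
  forall v w : G, adjacent v w -> exists i, i \in label v /\ i \in label w.

Definition corner_adjacent (n : nat) (G : ldigraph n) : Prop :=
  forall (v w : G) (i j k : 'I_n), i != j -> i != k -> j != k ->
  label v = [set i; j] -> label w = [set i; k] -> adjacent v w.

(** This sharpens condition (3): intersection graphs have exactly one direction here, which excludes
    an undirected edge. *)
Definition corner_oriented (n : nat) (G : ldigraph n) : Prop :=
  forall (v w : G) (i j k : 'I_n), i != j -> i != k -> j != k ->
  label v = [set i; j] -> label w = [set i; k] -> edge v w (+) edge w v.

Lemma corner_oriented_adjacent (n : nat) (G : ldigraph n) :
  corner_oriented G -> corner_adjacent G.
Proof.
move=> orient v w i j k ij ik jk vE wE; have := orient v w i j k ij ik jk vE wE.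
by rewrite /adjacent; case: edge; case: edge.
Qed.

(** Connectedness of a diagram read off the labels alone, so that it passes through isomorphisms and
    relabelings. *)
Definition color_connected (n : nat) (G : ldigraph n) : Prop :=
  forall A : {set 'I_n}, A != set0 -> ~: A != set0 ->
  exists (v : G) (i j : 'I_n), [/\ i \in A, j \notin A & label v = [set i; j]].

Lemma markedP (n : nat) (G : ldigraph n) (v : G) :
  reflect (marked v) (#|label v| == 2).
Proof.
apply: (iffP idP) => [/cards2P[i [j [ij lE]]]|[i [j [ij ->]]]]; first by exists i, j.
by rewrite cards2 ij.
Qed.

Lemma unmarked_label (n : nat) (G : ldigraph n) (v : G) (i : 'I_n) :
  #|label v| != 2 -> i \in label v -> label v = [set i].
Proof.
have [j [k ->]] := labelP v; rewrite cards2.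
by have [->|//] := eqVneq j k; rewrite setUid => _ /set1P->.
Qed.

Lemma marked_label (n : nat) (G : ldigraph n) (v : G) (i : 'I_n) :
  #|label v| == 2 -> i \in label v -> exists2 j, i != j & label v = [set i; j].
Proof.
move=> /cards2P[j [k [jk ->]]]; rewrite !inE => /orP[] /eqP->; first by exists k.
by exists j; rewrite 1?eq_sym // setUC.
Qed.

(** As [2 < n], some label leaves [[set i; j]]. It contains exactly one of [i] and [j], so the
    corner condition applies. Two vertices with the same marked label thus always have a common
    neighbor. *)
Lemma marked_common_neighbor (n : nat) (G : ldigraph n) (i j : 'I_n) :
  2 < n -> corner_adjacent G -> color_connected G -> i != j ->
  exists2 c : G, #|label c| == 2 &
    forall v : G, label v = [set i; j] -> adjacent c v.
Proof.
move=> hn corner conn ij.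
have [||c [a [l [aij lij cE]]]] := conn [set i; j].
- by apply/set0Pn; exists i; rewrite set21.
- by rewrite -card_gt0 cardsCs setCK card_ord cards2 ij subn_gt0.
have al : a != l by apply: contraNneq lij => <-.
exists c; first by rewrite cE cards2 al.
move=> v vE; move: lij aij; rewrite !inE negb_or => /andP[li lj].
case/orP=> /eqP aE; rewrite {a}aE in al cE.
  exact: corner al ij lj cE vE.
by apply: (corner c v j l i) => //; rewrite 1?eq_sym // setUC.
Qed.

(* Unmarked vertices carry a single color, so adjacency propagates it. *)
Lemma unmarked_path_color (n : nat) (G : ldigraph n) (v w : G) (p : seq G)
    (i : 'I_n) :
  shares_color G -> path (@adjacent n G) v (rcons p w) ->
  all (fun u : G => #|label u| != 2) p -> label v = [set i] -> i \in label w.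
Proof.
move=> share; elim: p v => [|u p IHp] v /=.
  by rewrite andbT => /share[j [jv jw]] _ vE; move: jv; rewrite vE => /set1P <-.
case/andP=> /share[j [jv ju]] up /andP[mu mp] vE.
rewrite vE in jv; rewrite (set1P jv) in ju.
exact: IHp up mp (unmarked_label mu ju).
Qed.

Lemma marked_not_undirected_connected (n : nat) (G : ldigraph n) :
  2 < n -> is_tree G -> shares_color G -> color_connected G ->
  corner_oriented G ->
  forall v w : G, v != w -> marked v -> marked w ->
  ~ connect (@undirected_edge n G) v w.
Proof.
move=> hn hG share conn orient v w vDw /markedP mv /markedP mw.
have corner := corner_oriented_adjacent orient.
case/connectP=> p0 p0P; case/shortenP: p0P => p pP up _ {p0} wE.
have hp : has (fun u : G => #|label u| == 2) p.
  apply/hasP; exists w => //; rewrite wE.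
  case: p {pP up} wE => [wE|x p _] /=; last exact: mem_last.
  by rewrite wE eqxx in vDw.
(* Cut the path at its first marked vertex after [v], again called [w]. The interior [s] is unmarked
   and carries a single color, which both ends share. *)
case/split_find: hp pP up {wE mw vDw w} => w s t mw ms.
rewrite cat_path -cat_cons cat_uniq => /andP[pP _] /andP[up _].
have {}ms : all (fun u : G => #|label u| != 2) s by rewrite all_predC.
have aP : path (@adjacent n G) v (rcons s w).
  by apply: sub_path pP => a b /andP[ab _]; rewrite /adjacent ab.
have [i [iv iw]] : exists i, i \in label v /\ i \in label w.
  case: s ms aP {pP up} => [_|u s] /=; first by rewrite andbT; apply: share.
  case/andP=> mu ms /andP[/share[i [iv iu]] us]; exists i; split=> //.
  exact: unmarked_path_color us ms (unmarked_label mu iu).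
have [j ij vE] := marked_label mv iv.
have [k ik wE] := marked_label mw iw.
(* If [j] and [k] differ, the ends are joined by a one-way edge: it contradicts a path of length one
   and closes a longer one into a cycle. If they are equal, a common neighbor of the two ends closes
   the cycle. *)
have [jk|jk] := eqVneq j k; last first.
  have := orient v w i j k ij ik jk vE wE.
  case: s {ms} aP up pP => [|u s] aP up pP vw.
    by move: pP; rewrite /= andbT => /andP[vw1 wv1]; rewrite vw1 wv1 in vw.
  apply: (negP (tree_path_closed hG aP up _)); first by rewrite /= size_rcons.
  by rewrite last_rcons /adjacent; case: edge vw; case: edge.
have [c mc cadj] := marked_common_neighbor hn corner conn ij.
apply: (negP (@tree_path_apex _ _ v c _ hG aP up _ _ (cadj v vE))).
- by rewrite size_rcons.
- have cv := tree_adjacent_neq hG (cadj v vE).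
  rewrite -jk in wE; have cw := tree_adjacent_neq hG (cadj w wE).
  rewrite inE mem_rcons inE !negb_or cv cw /=.
  by apply: contraTN mc => /(allP ms).
- by rewrite last_rcons adjacent_sym cadj // wE jk.
Qed.

(** * The colors form a path *)

Definition color_adjacent (n : nat) (G : ldigraph n) : rel 'I_n :=
  fun i j => (i != j) && [exists v : G, label v == [set i; j]].

Lemma color_adjacent_sym (n : nat) (G : ldigraph n) :
  symmetric (@color_adjacent n G).
Proof. by move=> i j; rewrite /color_adjacent eq_sym setUC. Qed.

(** Vertices labeled [[set x; a]], [[set x; b]] and [[set x; c]] would form a triangle. *)
Lemma color_adjacent_degree (n : nat) (G : ldigraph n) (x a b c : 'I_n) :
  is_tree G -> corner_adjacent G ->
  color_adjacent G x a -> color_adjacent G x b -> color_adjacent G x c ->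
  uniq [:: a; b; c] -> False.
Proof.
move=> hG corner /andP[xa /existsP[u /eqP uE]] /andP[xb /existsP[v /eqP vE]].
move=> /andP[xc /existsP[w /eqP wE]]; rewrite /= !inE negb_or andbT.
case/andP=> /andP[ab ac] bc.
have uv := corner _ _ _ _ _ xa xb ab uE vE.
have vw := corner _ _ _ _ _ xb xc bc vE wE.
apply: (negP (tree_triangle hG uv vw)).
by rewrite adjacent_sym (corner _ _ _ _ _ xa xc ac uE wE).
Qed.

Lemma next_next_neq (T : eqType) (p : seq T) (x : T) :
  uniq p -> 2 < size p -> x \in p -> next p (next p x) != x.
Proof.
move=> up sp xp; have [k q pE] := rot_to xp.
rewrite -!(next_rot k up); move: up sp; rewrite -(rot_uniq k) -(size_rot k) pE.
case: q {pE} => [|y [|z q]] //= /and3P[].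
rewrite !inE !negb_or => /and3P[xy xz _] /andP[yz _] _ _.
by rewrite eqxx [y == x]eq_sym (negbTE xy) eqxx eq_sym.
Qed.

(** Choosing a vertex for each edge of a cycle of colors gives a cycle in [G], since consecutive
    edges share exactly one color. *)
Lemma color_adjacent_acyclic (n : nat) (G : ldigraph n) (p : seq 'I_n) :
  is_tree G -> corner_adjacent G -> 2 < size p ->
  ~ ucycle (@color_adjacent n G) p.
Proof.
move=> hG corner sp /andP[cp up].
have adjp x : x \in p -> color_adjacent G x (next p x) by apply: next_cycle.
have [d _] : exists d : G, true.
  case: p {up sp cp} adjp sp => // x p /(_ x (mem_head _ _)).
  by case/andP=> _ /existsP[v _] _; exists v.
(* The default [d] is never returned for [x] in [p]. *)
pose f x : G := odflt d [pick v | label v == [set x; next p x]].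
have fE x : x \in p -> label (f x) = [set x; next p x].
  move/adjp/andP=> [_ /existsP[v vE]]; rewrite /f.
  by case: pickP => [w /eqP //|/(_ v)]; rewrite vE.
have nn x : x \in p -> next p (next p x) != x by apply: next_next_neq.
have nx x : x \in p -> x != next p x by move/adjp/andP=> [].
case: hG => _ _ /(_ (map f p)); rewrite size_map => /(_ sp); apply.
apply/andP; split.
  rewrite cycle_map; apply: cycle_from_next => // x xp /=.
  have yp : next p x \in p by rewrite mem_next.
  apply: (corner _ _ (next p x) x (next p (next p x))).
  - by rewrite eq_sym nx.
  - exact: nx.
  - by rewrite eq_sym nn.
  - by rewrite fE // setUC.
  - exact: fE.
(* Equal labels at distinct [x] and [y] would make each the successor of the other, impossible in a
   cycle of length at least 3. *)
rewrite map_inj_in_uniq // => x y xp yp /(congr1 (@label n G)); rewrite !fE // => xyE.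
apply/eqP/negPn/negP => xy.
have : x \in [set y; next p y] by rewrite -xyE set21.
have : y \in [set x; next p x] by rewrite xyE set21.
rewrite !inE eq_sym (negbTE xy) /= => /eqP yE /eqP xE.
by have := nn x xp; rewrite -yE -xE eqxx.
Qed.

(** A path missing some color has an edge leaving it, by connectedness. The degree bound lets this
    edge start only at an end of the path, which can then be prolonged. *)
Lemma color_adjacent_hamiltonian (n : nat) (G : ldigraph n) :
  is_tree G -> corner_adjacent G -> color_connected G ->
  exists p : seq 'I_n, [/\ uniq p, sorted (@color_adjacent n G) p & size p = n].
Proof.
move=> hG corner conn.
suff: forall k, k <= n -> exists p : seq 'I_n,
    [/\ uniq p, sorted (@color_adjacent n G) p & size p = k] by apply.
elim=> [|k IHk] kn; first by exists [::].
have [p [up sp pk]] := IHk (ltnW kn).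
case: k IHk kn pk => [_ n_gt0 _|k _ kn pk]; first by exists [:: Ordinal n_gt0].
have [||v [x [y [xp yp vE]]]] := conn [set x in p].
- case: p pk {up sp} => // x p _; apply/set0Pn; exists x.
  by rewrite inE mem_head.
- by rewrite -card_gt0 cardsCs setCK card_ord cardsE (card_uniqP up) pk subn_gt0.
rewrite inE in xp; rewrite inE in yp.
have xy : color_adjacent G x y.
  apply/andP; split; first by apply: contraNneq yp => <-.
  by apply/existsP; exists v; rewrite vE.
case/splitPr: xp up sp pk yp => p1 p2 up sp pk yp.
case/lastP: p1 up sp pk yp => [|p1 a] up sp pk yp.
  exists [:: y, x & p2]; split; first by rewrite cons_uniq yp.
    by rewrite /= color_adjacent_sym xy.
  by rewrite /= -pk.
case: p2 up sp pk yp => [|b p2] up sp pk yp.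
  exists (rcons (rcons p1 a ++ [:: x]) y); split.
  - by rewrite rcons_uniq yp.
  - move: sp; rewrite cats1; case: p1 {up pk yp} => [|c p1] /=.
      by rewrite xy andbT.
    by rewrite !rcons_path !last_rcons xy andbT.
  - by rewrite size_rcons pk.
rewrite cat_rcons in sp; have [_ /= /and3P[ax xb _]] := cat_sorted2 sp.
have [] := @color_adjacent_degree _ _ x a b y hG corner _ xb xy _.
  by rewrite color_adjacent_sym.
move: yp; rewrite mem_cat mem_rcons !inE !negb_or.
case/andP=> /andP[ya _] /and3P[_ yb _] /=.
move: up; rewrite cat_uniq => /and3P[_ /hasPn /(_ b)].
rewrite /= mem_rcons !inE eqxx orbT negb_or => /(_ isT) /andP[ba _] _.
by rewrite negb_or ![_ == y]eq_sym ya yb eq_sym ba.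
Qed.

Lemma color_path (n : nat) (G : ldigraph n) :
  is_tree G -> corner_adjacent G -> color_connected G ->
  exists s : 'S_n,
    (forall i j, color_adjacent G i j -> s j <= (s i).+1) /\
    (forall i j, s j = (s i).+1 :> nat -> color_adjacent G i j).
Proof.
move=> hG corner conn.
have [p [up sp pn]] := color_adjacent_hamiltonian hG corner conn.
have memp i : i \in p.
  have /subset_cardP : #|p| = #|'I_n| by rewrite card_ord (card_uniqP up).
  by move=> /(_ (subset_predT _)) ->.
have ltp i : index i p < n by rewrite -[X in _ < X]pn index_mem.
pose f i := Ordinal (ltp i).
have f_inj : injective f.
  move=> i j /(congr1 val) /= ij.
  by rewrite -(nth_index i (memp i)) ij nth_index.
exists (perm f_inj); split=> i j; rewrite !permE /=; last first.
  move=> jE.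
  have : (index i p).+1 < size p by rewrite -jE index_mem.
  move/(sortedP i): sp => /[apply].
  by rewrite -jE !nth_index.
(* If [j] came more than one step after [i], the stretch of [p] from [i] to [j] would have at least
   three colors, and [ij] would close it into a cycle. *)
move=> ij; rewrite leqNgt; apply/negP => lt_ij.
have qE : drop (index i p) p = i :: drop (index i p).+1 p.
  by rewrite (drop_nth i) ?index_mem // nth_index.
have jq : j \in drop (index i p).+1 p.
  have := memp j; rewrite -{1}(cat_take_drop (index i p).+1 p) mem_cat.
  by case/orP=> // /index_ltn; lia.
have lt_ip : (index i p).+1 < size p by rewrite (ltn_trans lt_ij) ?index_mem.
have nth1 : nth i (drop (index i p).+1 p) 0 != j.
  rewrite nth_drop addn0; apply: contraTneq lt_ij => <-.
  by rewrite index_uniq ?ltnn.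
have := drop_sorted (index i p) sp; have := drop_uniq (index i p) up.
rewrite {}qE; case/splitPr: jq nth1 => q1 q2 nth1.
rewrite -cat_rcons -cat_cons cat_uniq /= cat_path => /andP[uq _] /andP[qpath _].
case: (@color_adjacent_acyclic _ _ (i :: rcons q1 j) hG corner).
  by case: q1 nth1 {uq qpath} => [|x q1]; rewrite /= ?eqxx // size_rcons.
by rewrite /ucycle /= uq rcons_path last_rcons qpath color_adjacent_sym ij.
Qed.

(** * Parity properties of intersection graphs *)

Lemma odd_card_bool_pair (P : pred (bool * bool)) :
  odd #|[set p | P p]| =
  P (false, false) (+) P (false, true) (+) P (true, false) (+) P (true, true).
Proof.
have -> : #|[set p | P p]| = \sum_a \sum_b nat_of_bool (P (a, b)).
  rewrite -sum1_card big_mkcond pair_bigA; apply: eq_bigr => -[a b] _ /=.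
  by rewrite inE; case: (P _).
rewrite !big_bool /=.
by do 4! case: (P _).
Qed.

Lemma eq_set2 (T : finType) (a b i j : T) :
  i != j -> [set a; b] = [set i; j] -> a = i /\ b = j \/ a = j /\ b = i.
Proof.
move=> ij abE; have : a \in [set i; j] by rewrite -abE set21.
have : b \in [set i; j] by rewrite -abE set22.
have : #|[set a; b]| = 2 by rewrite abE cards2 ij.
rewrite cards2 !inE; case: eqVneq => // ab _.
by move=> /orP[] /eqP bE /orP[] /eqP aE; auto; rewrite aE bE eqxx in ab.
Qed.

Lemma before_addb (d n : nat) (D : chord_diagram d n) (e f : 'I_d * bool) :
  e != f -> before D e f (+) before D f e = (Defs.comp D e == Defs.comp D f).
Proof.
move=> ef; case: (Defs.comp D e =P Defs.comp D f) => [c|c].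
  have := before_total c ef; have := @before_trans _ _ D f e e.
  rewrite before_irr.
  by case: before => //; case: before => // /(_ isT isT).
have /negbTE -> : ~~ before D e f by apply/negP => /before_comp.
by apply/negbTE/negP => /before_comp/esym.
Qed.

Lemma ig_edge_addb (d n : nat) (D : chord_diagram d n) (v w : 'I_d) :
  v != w ->
  ig_edge D v w (+) ig_edge D w v =
  (Defs.comp D (v, false) == Defs.comp D (w, false)) (+)
  (Defs.comp D (v, false) == Defs.comp D (w, true)) (+)
  (Defs.comp D (v, true) == Defs.comp D (w, false)) (+)
  (Defs.comp D (v, true) == Defs.comp D (w, true)).
Proof.
move=> vw; have neq a b : (v, a) != (w, b) by rewrite xpair_eqE (negbTE vw).
rewrite /ig_edge [w == v]eq_sym vw /= !odd_card_bool_pair /= -!before_addb //.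
by do 8! case: before.
Qed.

(** Both ends of [v] lie on one component, so each end of [w] there is counted twice and the two
    directions have the same parity. *)
Lemma ig_semisymmetric (d n : nat) (D : chord_diagram d n) :
  semisymmetric (intersection_graph D).
Proof.
move=> v i /= vE w wv.
have [v0 v1] : Defs.comp D (v, false) = i /\ Defs.comp D (v, true) = i.
  by split; apply/set1P; rewrite -[[set i]]setUid -vE ?set21 ?set22.
have := @ig_edge_addb _ _ D v w; rewrite eq_sym => /(_ wv); rewrite v0 v1.
by do 2! case: ig_edge => //; do 2! case: eqP.
Qed.

Lemma ig_oriented (d n : nat) (D : chord_diagram d n) :
  corner_oriented (intersection_graph D).
Proof.
move=> v w i j k ij ik jk /= vE wE.
have vw : v != w.
  apply: contra_neq jk => vw; rewrite vw wE in vE.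
  have : k \in [set i; j] by rewrite -vE set22.
  by rewrite !inE [k == i]eq_sym (negbTE ik) => /eqP.
have [ji ki kj] : [/\ j == i = false, k == i = false & k == j = false].
  by split; apply/negbTE; rewrite eq_sym.
rewrite /= ig_edge_addb //.
by case: (eq_set2 ij vE) => -[-> ->]; case: (eq_set2 ik wE) => -[-> ->];
  rewrite eqxx ?ji ?ki ?kj ?(negbTE ij) ?(negbTE ik) ?(negbTE jk).
Qed.

Lemma ig_shares_color (d n : nat) (D : chord_diagram d n) :
  shares_color (intersection_graph D).
Proof.
have ends (v : 'I_d) b : Defs.comp D (v, b) \in ig_label D v.
  by case: b; rewrite ?set21 ?set22.
have share v w : ig_edge D v w ->
    exists i, i \in ig_label D v /\ i \in ig_label D w.
  case/andP=> _ oddS; have /set0Pn[[a b]] :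
      [set p : bool * bool | before D (v, p.1) (w, p.2)] != set0.
    by apply: contraTneq oddS => ->; rewrite cards0.
  rewrite inE /= => /before_comp vw; exists (Defs.comp D (v, a)).
  by rewrite ends vw ends.
by move=> v w /orP[/share//|/share[i [iw iv]]]; exists i.
Qed.

Lemma ig_color_connected (d n : nat) (D : chord_diagram d n) :
  connected_diagram D -> color_connected (intersection_graph D).
Proof.
move=> conn A A0 CA0; case: (boolP [forall c : 'I_d,
    (Defs.comp D (c, false) \in A) == (Defs.comp D (c, true) \in A)]) => [/forallP cA|].
  by case: (conn A A0 CA0) => c; apply/eqP.
case/forallPn=> c; rewrite /= /ig_label.
case c0: (_ \in A); case c1: (_ \in A) => // _; exists c.
  by exists (Defs.comp D (c, false)), (Defs.comp D (c, true)); rewrite c0 c1.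
by exists (Defs.comp D (c, true)), (Defs.comp D (c, false)); rewrite c0 c1 [RHS]setUC.
Qed.

Lemma iso_intersection_graph (d n : nat) (D : chord_diagram d n)
    (T : ldigraph n) :
  connected_diagram D -> ldigraph_iso T (intersection_graph D) ->
  [/\ shares_color T, semisymmetric T, corner_oriented T & color_connected T].
Proof.
move=> conn [f [[g fK gK] fE fl]]; split.
- move=> v w; rewrite /adjacent -!fE => /ig_shares_color [i].
  by rewrite !fl => iP; exists i.
- move=> v i; rewrite -fl => /ig_semisymmetric sym w wv.
  by rewrite -!fE; apply: sym; rewrite (can_eq fK).
- by move=> v w i j k ij ik jk; rewrite -!fl -!fE; apply: ig_oriented.
- move=> A A0 CA0; have [v [i [j [iA jA vE]]]] := ig_color_connected conn A0 CA0.
  by exists (g v), i, j; rewrite -fl gK.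
Qed.

(** * Relabeling, and multiplicities of labels *)

Lemma relabel_label (n : nat) (s : 'S_n) (A : {set 'I_n}) (i j : 'I_n) :
  s @: A = [set i; j] -> A = [set (s^-1)%g i; (s^-1)%g j].
Proof.
move=> AE; rewrite -!imset_set1 -imsetU -AE -imset_comp.
by rewrite (eq_imset _ (permK s)) imset_id.
Qed.

Lemma relabel_intersection_graph (n : nat) (T : ldigraph n) (s : 'S_n) :
  [/\ shares_color T, semisymmetric T, corner_oriented T & color_connected T] ->
  [/\ shares_color (relabel T s), semisymmetric (relabel T s),
      corner_oriented (relabel T s) & color_connected (relabel T s)].
Proof.
case=> share sym orient conn; split.
- move=> v w /share[i [iv iw]]; exists (s i).
  by split; apply: imset_f.
- by move=> v i /relabel_label vE; apply: sym vE.
- move=> v w i j k ij ik jk /relabel_label vE /relabel_label wE.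
  by apply: (orient v w _ _ _ _ _ _ vE wE); rewrite (inj_eq perm_inj).
- move=> A A0 CA0; have [||v [i [j [iA jA vE]]]] := conn (s @^-1: A).
  + case/set0Pn: A0 => i iA; apply/set0Pn; exists ((s^-1)%g i).
    by rewrite inE permKV.
  + case/set0Pn: CA0 => i iA; apply/set0Pn; exists ((s^-1)%g i).
    by move: iA; rewrite !inE permKV.
  + exists v, (s i), (s j); rewrite !inE in iA jA.
    by split=> //=; rewrite vE imsetU !imset_set1.
Qed.

Lemma relabel_color_path (n : nat) (T : ldigraph n) :
  is_tree T -> corner_adjacent T -> color_connected T ->
  exists s : 'S_n,
    (forall i j, color_adjacent (relabel T s) i j -> j <= i.+1) /\
    (forall i j : 'I_n, j = i.+1 :> nat -> color_adjacent (relabel T s) i j).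
Proof.
move=> hT corner conn; have [s [le_s s_adj]] := color_path hT corner conn.
have relE i j :
    color_adjacent (relabel T s) i j = color_adjacent T ((s^-1)%g i) ((s^-1)%g j).
  rewrite /color_adjacent (inj_eq perm_inj); congr (_ && _).
  apply/existsP/existsP => -[v /eqP vE]; exists v; apply/eqP.
    exact: relabel_label vE.
  by rewrite /= vE imsetU !imset_set1 !permKV.
exists s; split=> i j; rewrite relE; first by move=> /le_s; rewrite !permKV.
by move=> ij; apply: s_adj; rewrite !permKV.
Qed.

Lemma label_mult_gt0 (n : nat) (T : ldigraph n) (i j : 'I_n) :
  color_adjacent T i j -> 0 < label_mult T i j.
Proof.
case/andP=> _ /existsP[v vE]; rewrite /label_mult card_gt0.
by apply/set0Pn; exists v; rewrite inE.
Qed.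

(** Two vertices labeled [[set i; j]] would both be adjacent to a vertex labeled [[set h; i]] and to
    one labeled [[set j; k]], giving a 4-cycle. *)
Lemma label_mult_le1 (n : nat) (T : ldigraph n) (h i j k : 'I_n) :
  is_tree T -> corner_adjacent T -> uniq [:: h; i; j; k] ->
  color_adjacent T h i -> color_adjacent T j k -> label_mult T i j <= 1.
Proof.
move=> hT corner /= uhk /andP[_ /existsP[c /eqP cE]] /andP[_ /existsP[d /eqP dE]].
move: uhk; rewrite !inE !negb_or => /and4P[/and3P[hi hj hk] /andP[ij ik] jk _].
apply/card_le1_eqP => v w; rewrite !inE => /eqP vE /eqP wE.
apply/eqP/negPn/negP => vw.
have cadj x : label x = [set i; j] -> adjacent c x.
  move=> xE; apply: (corner c x i h j) => //; first by rewrite eq_sym.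
  by rewrite cE setUC.
have dadj x : label x = [set i; j] -> adjacent x d.
  move=> xE; apply: (corner x d j i k) => //; first by rewrite eq_sym.
  by rewrite xE setUC.
have cd : c != d.
  apply: contraNneq hj => cd; have : h \in [set j; k] by rewrite -dE -cd cE set21.
  by rewrite !inE (negbTE hk) orbF.
apply: (negP (@tree_path_closed _ _ c [:: v; d; w] hT _ _ _)) => //=.
- by rewrite cadj // dadj // adjacent_sym dadj.
- have [cv cw] := (tree_adjacent_neq hT (cadj v vE), tree_adjacent_neq hT (cadj w wE)).
  have [vd wd] := (tree_adjacent_neq hT (dadj v vE), tree_adjacent_neq hT (dadj w wE)).
  by rewrite !inE !negb_or cv cd cw vd ![_ == w]eq_sym vw wd.
- by rewrite adjacent_sym cadj.
Qed.

(** * Placing the ends of chords one chord at a time *)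

Definition xor4 (b : bool -> bool -> bool) : bool :=
  b false false (+) b false true (+) b true false (+) b true true.

(* [cmp] gives the component of an end; only the relative order of the values of
   [pos] on a component matters. *)
Definition realizes (n : nat) (G : ldigraph n) (cmp : G * bool -> 'I_n)
    (pos : G * bool -> nat) (S : {set G}) : Prop :=
  {in [pred e | e.1 \in S] &, injective pos} /\
  {in S &, forall v w, v != w -> edge v w = xor4 (fun a b =>
     (cmp (v, a) == cmp (w, b)) && (pos (v, a) < pos (w, b)))}.

(** The strictly increasing [phi] spreads the old positions to make room without changing their
    order, so the edges inside [S] survive. Only pairs involving [u], whose ends go to the values of
    [x], remain to be checked. *)
Lemma realizes_extend (n : nat) (G : ldigraph n) (cmp : G * bool -> 'I_n)
    (pos : G * bool -> nat) (S : {set G}) (u : G) (x : bool -> nat)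
    (phi : nat -> nat) :
  realizes cmp pos S -> u \notin S ->
  {mono phi : i j / i < j} -> injective x ->
  (forall b e, e.1 \in S -> x b != phi (pos e)) ->
  {in S, forall w, edge u w = xor4 (fun a b =>
     (cmp (u, a) == cmp (w, b)) && (x a < phi (pos (w, b))))} ->
  {in S, forall w, edge w u = xor4 (fun a b =>
     (cmp (w, a) == cmp (u, b)) && (phi (pos (w, a)) < x b))} ->
  exists pos', realizes cmp pos' (u |: S).
Proof.
move=> [pos_inj posE] uS phi_mono x_inj x_new uE Eu.
have phi_inj : injective phi.
  move=> i j ij; have := phi_mono i j; have := phi_mono j i.
  by rewrite ij ltnn; lia.
have neq_u w : w \in S -> (w == u) = false.
  by move=> wS; apply: contraNF uS => /eqP <-.
exists (fun e => if e.1 == u then x e.2 else phi (pos e)); split.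
  move=> [v a] [w b]; rewrite !inE /=.
  have [-> _|vu /= vS] := eqVneq v u; have [-> _|wu /= wS] := eqVneq w u.
  - by move/x_inj->.
  - by move/eqP; rewrite (negbTE (x_new _ _ _)).
  - by move/esym/eqP; rewrite (negbTE (x_new _ _ _)).
  - by move/phi_inj; apply: pos_inj.
move=> v w; rewrite !inE.
have [-> _|vu /= vS] := eqVneq v u; have [-> _|wu /= wS] := eqVneq w u => //.
- by move=> _; rewrite uE.
- by move=> _; rewrite Eu.
- by move=> vw; rewrite posE // /xor4 !phi_mono.
Qed.

Lemma realizes_source (n : nat) (G : ldigraph n) (cmp : G * bool -> 'I_n)
    (pos : G * bool -> nat) (S : {set G}) (u : G) :
  realizes cmp pos S -> u \notin S ->
  {in S, forall w, edge u w = xor4 (fun a b => cmp (u, a) == cmp (w, b))} ->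
  {in S, forall w, edge w u = false} ->
  exists pos', realizes cmp pos' (u |: S).
Proof.
move=> posS uS uE Eu.
(* Shifting by 2 frees the positions 0 and 1 for the ends of [u]. *)
apply: (@realizes_extend _ _ _ _ _ u nat_of_bool (fun i => i.+2) posS) => //.
- by case; case.
- by case.
- by move=> w wS; rewrite uE // /xor4 !andbT.
- by move=> w wS; rewrite Eu // /xor4 /= !ltnS ?ltn0 !andbF.
Qed.

Lemma realizes_sink (n : nat) (G : ldigraph n) (cmp : G * bool -> 'I_n)
    (pos : G * bool -> nat) (S : {set G}) (u : G) :
  realizes cmp pos S -> u \notin S ->
  {in S, forall w, edge w u = xor4 (fun a b => cmp (w, a) == cmp (u, b))} ->
  {in S, forall w, edge u w = false} ->
  exists pos', realizes cmp pos' (u |: S).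
Proof.
move=> posS uS Eu uE; pose M := (\max_e pos e).+1.
have ltM e : pos e < M by rewrite ltnS leq_bigmax.
apply: (@realizes_extend _ _ _ _ _ u (fun b => M + b) id posS) => //.
- by move=> a b /addnI; case: a; case: b.
- by move=> b e _; rewrite gtn_eqF // ltn_addr.
- move=> w wS; rewrite uE // /xor4 !(ltnNge (M + _)).
  by rewrite !(ltnW (ltn_addr _ (ltM _))) !andbF.
- by move=> w wS; rewrite Eu // /xor4 !(ltn_addr _ (ltM _)) !andbT.
Qed.

(* A chord whose two ends immediately surround the end [(p, c)] crosses only
   the chord [p]. *)
Lemma realizes_around (n : nat) (G : ldigraph n) (cmp : G * bool -> 'I_n)
    (pos : G * bool -> nat) (S : {set G}) (u p : G) (c : bool) :
  realizes cmp pos S -> u \notin S -> p \in S ->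
  (forall b, cmp (u, b) = cmp (p, c)) ->
  {in S, forall w, edge u w = (w == p)} ->
  {in S, forall w, edge w u = (w == p)} ->
  exists pos', realizes cmp pos' (u |: S).
Proof.
move=> posS uS pS cmpu uE Eu; have [pos_inj _] := posS.
have posE w b : w \in S -> (pos (w, b) == pos (p, c)) = (w == p) && (b == c).
  move=> wS; rewrite -xpair_eqE; apply/eqP/eqP => [|-> //].
  by apply: pos_inj; rewrite inE.
(* Old positions become 2 mod 4, so the odd positions just below and just above the image of
   [(p, c)] are free. *)
apply: (@realizes_extend _ _ _ _ _ u (fun b => 4 * pos (p, c) + 1 + 2 * b)
  (fun i => 4 * i + 2) posS) => //.
- by move=> i j; lia.
- by case; case=> //; lia.
- by move=> b e _; lia.
- move=> w wS; rewrite uE // /xor4 !cmpu.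
  (* The two ends of [u] compare differently with an old end only if that end is [(p, c)]; all other
     contributions cancel. *)
  have wb b : (cmp (p, c) == cmp (w, b)) &&
      (4 * pos (p, c) + 1 + 2 * false < 4 * pos (w, b) + 2) (+)
      (cmp (p, c) == cmp (w, b)) &&
      (4 * pos (p, c) + 1 + 2 * true < 4 * pos (w, b) + 2) =
      (w == p) && (b == c).
    rewrite -posE // -andb_addr.
    have [e|ne] := eqVneq (pos (w, b)) (pos (p, c)).
      move/eqP: (e); rewrite posE // => /andP[/eqP-> /eqP->]; rewrite eqxx.
      by lia.
    by case: (_ == _) => //=; lia.
  by have := wb false; have := wb true; case: c {pS cmpu posE wb};
    do 4! case: (_ && (_ < _)) => //=; case: (w == p).
- move=> w wS; rewrite Eu // /xor4 !cmpu.
  have wb b : (cmp (w, b) == cmp (p, c)) &&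
      (4 * pos (w, b) + 2 < 4 * pos (p, c) + 1 + 2 * false) (+)
      (cmp (w, b) == cmp (p, c)) &&
      (4 * pos (w, b) + 2 < 4 * pos (p, c) + 1 + 2 * true) =
      (w == p) && (b == c).
    rewrite -posE // -andb_addr.
    have [e|ne] := eqVneq (pos (w, b)) (pos (p, c)).
      move/eqP: (e); rewrite posE // => /andP[/eqP-> /eqP->]; rewrite eqxx.
      by lia.
    by case: (_ == _) => //=; lia.
  by have := wb false; have := wb true; case: c {pS cmpu posE wb};
    do 4! case: (_ && (_ < _)) => //=; case: (w == p).
Qed.

(** Adjacency is the parity of the number of shared colors: none is excluded by (1), one forces
    adjacency by (3), and with two the common neighbor of [v] and [w] would complete a triangle. *)
Lemma marked_adjacentE (n : nat) (G : ldigraph n) (v w : G) (a b c d : 'I_n) :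
  2 < n -> is_tree G -> shares_color G -> corner_adjacent G ->
  color_connected G ->
  a != b -> c != d -> label v = [set a; b] -> label w = [set c; d] ->
  adjacent v w = (a == c) (+) (a == d) (+) (b == c) (+) (b == d).
Proof.
move=> hn hG share corner conn ab cd vE wE.
have same : label v = label w -> adjacent v w = false.
  move=> vwE; have [e _ eadj] := marked_common_neighbor hn corner conn ab.
  apply: contraTF (eadj _ vE) => vw; apply: (tree_triangle hG vw).
  by rewrite adjacent_sym eadj // -vwE.
have [ac|ac] := eqVneq a c.
  rewrite -ac in cd wE *; rewrite (negbTE cd) [b == a]eq_sym (negbTE ab) /=.
  have [bd|bd] := eqVneq b d; first by rewrite same // vE wE bd.
  exact: corner ab cd bd vE wE.
have [ad|ad] := eqVneq a d.
  rewrite -ad in cd wE *; rewrite [b == a]eq_sym (negbTE ab) /=.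
  have [bc|bc] := eqVneq b c; first by rewrite same // vE wE bc setUC.
  by apply: (corner v w a b c) => //; rewrite wE setUC.
have [bc|bc] := eqVneq b c.
  rewrite -bc in cd wE *; rewrite (negbTE cd) /=.
  apply: (corner v w b a d) => //; first by rewrite eq_sym.
  by rewrite vE setUC.
have [bd|bd] := eqVneq b d.
  rewrite -bd in cd wE *.
  apply: (corner v w b a c) => //.
  - by rewrite eq_sym.
  - by rewrite vE setUC.
  - by rewrite wE setUC.
apply/negP => /share[i []]; rewrite vE wE !inE.
by case/orP=> /eqP->; rewrite ?(negbTE ac) ?(negbTE ad) ?(negbTE bc) ?(negbTE bd).
Qed.

Lemma tree_realizable (n : nat) (G : ldigraph n) (cmp : G * bool -> 'I_n) :
  2 < n -> is_tree G -> shares_color G -> semisymmetric G ->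
  corner_adjacent G -> color_connected G ->
  (forall v w : G, v != w -> marked v -> marked w ->
     ~ connect (@undirected_edge n G) v w) ->
  (forall v, label v = [set cmp (v, false); cmp (v, true)]) ->
  exists pos, realizes cmp pos setT.
Proof.
move=> hn hG share sym corner conn isolated cmpE.
have mE v : (#|label v| == 2) = (cmp (v, false) != cmp (v, true)).
  by rewrite cmpE cards2; case: (_ != _).
have [r mr] : exists r : G, #|label r| == 2.
  have n_gt0 : 0 < n by apply: leq_trans hn.
  have [||r [i [j [/set1P iE jE rE]]]] := conn [set Ordinal n_gt0].
  - by apply/set0Pn; exists (Ordinal n_gt0); rewrite set11.
  - by rewrite -card_gt0 cardsCs setCK card_ord cards1 subn_gt0 ltnW.
  - by exists r; rewrite rE cards2; move: jE; rewrite inE iE eq_sym => ->.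
(* The first clause, together with (6), makes the neighbor in S of a new
   marked vertex marked. *)
pose P (S : {set G}) := (forall x, x \in S -> exists m, [/\ m \in S,
    #|label m| == 2 & connect (@undirected_edge n G) x m]) /\
  exists pos, realizes cmp pos S.
suff [] : P setT by [].
apply: (tree_ind (r := r) hG); rewrite /P.
  split=> [x /set1P->|]; first by exists r; rewrite set11.
  exists (fun e => nat_of_bool e.2); split.
    by move=> [v a] [w b]; rewrite !inE => /eqP /= -> /eqP -> /=; case: a; case: b.
  by move=> v w /set1P-> /set1P->; rewrite eqxx.
move=> S u p [Sm [pos posS]] uS pS up up_only.
have uDS w : w \in S -> w != u by move=> wS; apply: contraNneq uS => <-.
have nadj w : w \in S -> w != p -> adjacent u w = false.
  by move=> wS; apply: contraNF => /up_only ->.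
have [mu|mu] := boolP (#|label u| == 2); last first.
  have uc b : cmp (u, b) = cmp (u, false).
    by move: mu; rewrite mE negbK => /eqP; case: b.
  have u_sym w : w \in S -> edge u w = edge w u.
    move=> wS; have := sym u (cmp (u, false)); rewrite cmpE uc => /(_ erefl).
    by move=> /(_ w (uDS w wS)) [uw wu]; apply/idP/idP.
  have uE : {in S, forall w, edge u w = (w == p)}.
    move=> w wS; have [->|wp] := eqVneq w p.
      by move: up; rewrite /adjacent -u_sym // orbb.
    by have := nadj w wS wp; rewrite /adjacent -u_sym // orbb.
  split.
    (* The edge between [u] and [p] is undirected, so the marked vertex reached from [p] also serves
       [u]. *)
    have [m [mS mm pm]] := Sm p pS.
    move=> x /setU1P[->|/Sm[k [kS km xk]]]; last by exists k; rewrite inE kS orbT.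
    exists m; rewrite inE mS orbT; split=> //.
    apply: connect_trans pm; apply: connect1.
    by rewrite /undirected_edge -u_sym // uE // eqxx.
  have [i []] := share u p up; rewrite !cmpE uc setUid => /set1P -> pi.
  have [c cE] : exists c, cmp (u, false) = cmp (p, c).
    by case/set2P: pi => ->; [exists false | exists true].
  apply: (@realizes_around _ _ _ _ _ u p c posS) => //.
  - by move=> b; rewrite uc.
  - by move=> w wS; rewrite -u_sym // uE.
split.
  move=> x /setU1P[->|/Sm[k [kS km xk]]]; last by exists k; rewrite inE kS orbT.
  by exists u; rewrite setU11.
have isolated_u w : w \in S -> #|label w| == 2 ->
    ~ connect (@undirected_edge n G) w u.
  by move=> wS mw; apply: isolated; [exact: uDS | apply/markedP | apply/markedP].
(* If [p] were unmarked, its edge to [u] would be undirected by (2), and through [p] an undirected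
   path would join [u] to a marked vertex of [S], against (6). *)
have mp : #|label p| == 2.
  apply/negPn/negP => mp; have [m [mS mm pm]] := Sm p pS.
  apply: (isolated u m); [by rewrite eq_sym uDS | exact/markedP | exact/markedP |].
  apply: connect_trans pm; apply: connect1; rewrite /undirected_edge.
  have pc : cmp (p, false) = cmp (p, true) by apply/eqP; rewrite mE negbK in mp.
  have := sym p (cmp (p, false)); rewrite cmpE -pc => /(_ erefl u).
  rewrite eq_sym uDS // => /(_ isT) [pu up']; apply/andP.
  by case/orP: up => [e|e]; split=> //; [exact: up' | exact: pu].
(* For unmarked [w] the two ends lie on one component and the terms cancel in pairs; such a [w] is
   not [p], which is marked. *)
have xorE w : w \in S ->
    xor4 (fun a b => cmp (u, a) == cmp (w, b)) = (w == p).
  move=> wS; have [mw|mw] := boolP (#|label w| == 2).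
    rewrite mE in mu; rewrite mE in mw.
    rewrite /xor4 -(marked_adjacentE hn hG share corner conn mu mw (cmpE u) (cmpE w)).
    by have [->|/nadj ->] := eqVneq w p.
  rewrite (negbTE (contraNneq _ mw)); last by move->.
  by move: mw; rewrite mE negbK /xor4 => /eqP ->; do 2! case: (_ == _).
have not_both : edge u p && edge p u = false.
  by apply: contraPF (isolated_u p pS mp) => /andP[upE puE] /(_ (connect1 _));
    apply; rewrite /undirected_edge puE.
have [upE|upE] := boolP (edge u p).
  rewrite upE /= in not_both; apply: (realizes_source posS) => // w wS.
    rewrite xorE //; have [->//|wp] := eqVneq w p.
    by have := nadj w wS wp; rewrite /adjacent => /norP[/negbTE].
  have [->//|wp] := eqVneq w p.
  by have := nadj w wS wp; rewrite /adjacent => /norP[_ /negbTE].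
have puE : edge p u by move: up; rewrite /adjacent (negbTE upE).
have xorC w : xor4 (fun a b => cmp (w, a) == cmp (u, b)) =
              xor4 (fun a b => cmp (u, a) == cmp (w, b)).
  by rewrite /xor4 ![cmp (w, _) == _]eq_sym; do 4! case: (_ == _).
apply: (realizes_sink posS) => // w wS.
  rewrite xorC xorE //; have [->//|wp] := eqVneq w p.
  by have := nadj w wS wp; rewrite /adjacent => /norP[_ /negbTE].
have [->|wp] := eqVneq w p; first exact/negbTE.
by have := nadj w wS wp; rewrite /adjacent => /norP[/negbTE].
Qed.

(** * From positions to connected chord diagrams *)

Lemma realizes_diagram (n : nat) (G : ldigraph n) (cmp : G * bool -> 'I_n)
    (pos : G * bool -> nat) :
  irreflexive (@edge n G) ->
  (forall v, label v = [set cmp (v, false); cmp (v, true)]) ->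
  realizes cmp pos setT ->
  exists D : chord_diagram #|G| n, ldigraph_iso G (intersection_graph D).
Proof.
move=> irr cmpE [pos_inj posE].
pose ev (e : 'I_#|G| * bool) : G * bool := (enum_val e.1, e.2).
pose bef : rel ('I_#|G| * bool) := fun e f =>
  (cmp (ev e) == cmp (ev f)) && (pos (ev e) < pos (ev f)).
have bef_comp e f : bef e f -> cmp (ev e) = cmp (ev f) by case/andP=> /eqP.
have bef_irr : irreflexive bef by move=> e; rewrite /bef ltnn andbF.
have bef_trans : transitive bef.
  move=> f e g /andP[/eqP ef lt_ef] /andP[/eqP fg lt_fg].
  by rewrite /bef ef fg eqxx (ltn_trans lt_ef).
have bef_total e f : cmp (ev e) = cmp (ev f) -> e != f -> bef e f || bef f e.
  move=> ef; apply: contraNT; rewrite /bef ef eqxx /= negb_or -!leqNgt.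
  rewrite -eqn_leq => /eqP /pos_inj; rewrite !inE => /(_ isT isT) [].
  by case: e f {ef} => [v a] [w b] /= /enum_val_inj -> ->.
exists (ChordDiagram bef_comp bef_irr bef_trans bef_total), enum_rank; split.
- exact: enum_rank_bij.
- move=> v w /=; rewrite /ig_edge (inj_eq enum_rank_inj) odd_card_bool_pair /=.
  have [->|vw] := eqVneq v w; first by rewrite irr.
  by rewrite posE ?inE // /bef /ev /= !enum_rankK.
- by move=> v; rewrite cmpE /= /ig_label /= /ev /= enum_rankK.
Qed.

Lemma iso_connected_diagram (d n : nat) (D : chord_diagram d n)
    (T : ldigraph n) :
  color_connected T -> ldigraph_iso T (intersection_graph D) ->
  connected_diagram D.
Proof.
move=> conn [f [_ _ fl]] A A0 CA0 cA.
have [v [i [j [iA jA]]]] := conn A A0 CA0.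
rewrite -fl => fE; have ij : i != j by apply: contraNneq jA => <-.
by have := cA (f v); case: (eq_set2 ij fE) => -[-> ->]; rewrite iA (negbTE jA).
Qed.

(** Rename the components by the inverse permutation and keep the order of the ends. *)
Lemma unrelabel_diagram (d n : nat) (D : chord_diagram d n) (T : ldigraph n)
    (s : 'S_n) :
  connected_diagram D -> ldigraph_iso (relabel T s) (intersection_graph D) ->
  exists D' : chord_diagram d n,
    connected_diagram D' /\ ldigraph_iso T (intersection_graph D').
Proof.
move=> conn [f [f_bij fE fl]]; pose c e := (s^-1)%g (Defs.comp D e).
have cP e g : before D e g -> c e = c g by rewrite /c => /before_comp ->.
have c_total e g : c e = c g -> e != g -> before D e g || before D g e.
  by move/perm_inj; apply: before_total.
exists (ChordDiagram cP (@before_irr _ _ D) (@before_trans _ _ D) c_total).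
split; last first.
  exists f; split=> // v; rewrite /= /ig_label /= /c.
  by apply/esym/relabel_label; rewrite -[LHS]fl.
move=> A A0 CA0 cA; apply: (conn [set i | (s^-1)%g i \in A]).
- by case/set0Pn: A0 => i iA; apply/set0Pn; exists (s i); rewrite inE permK.
- case/set0Pn: CA0 => i iA; apply/set0Pn; exists (s i).
  by move: iA; rewrite !inE permK.
- by move=> e; rewrite !inE; apply: cA.
Qed.

(** A set of colors that never separates [i] from [i.+1] is empty or everything, so a proper
    nonempty one is crossed by a label of consecutive colors. *)
Lemma consecutive_color_connected (n : nat) (G : ldigraph n) :
  (forall i j : 'I_n, j = i.+1 :> nat -> 0 < label_mult G i j) ->
  color_connected G.
Proof.
move=> mult A /set0Pn[a aA] /set0Pn[b]; rewrite inE => bA.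
case: (boolP [forall i : 'I_n, forall j : 'I_n,
    (j == i.+1 :> nat) ==> ((i \in A) == (j \in A))]) => [/forallP constA|].
  have n_gt0 : 0 < n by apply: leq_ltn_trans (ltn_ord a).
  suff same k (hk : k < n) : (Ordinal hk \in A) = (Ordinal n_gt0 \in A).
    case: a b aA bA => [i hi] [j hj]; rewrite !same => ->.
    by [].
  elim: k hk => [|k IHk] hk; first by congr (_ \in A); apply: val_inj.
  rewrite -(IHk (ltnW hk)); apply/esym/eqP.
  by have /forallP/(_ (Ordinal hk))/implyP := constA (Ordinal (ltnW hk)); apply.
case/forallPn=> i /forallPn[j]; rewrite negb_imply => /andP[/eqP ij ijA].
have := mult i j ij; rewrite card_gt0 => /set0Pn[v]; rewrite inE => /eqP vE.
exists v; case iA: (i \in A) ijA => jA.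
  by exists i, j; rewrite iA.
by exists j, i; rewrite iA setUC; split=> //; case: (j \in A) jA.
Qed.

Theorem theorem3 (n : nat) (hn : 2 < n) (T : ldigraph n) (hT : is_tree T) :
  (exists (d : nat) (D : chord_diagram d n),
      connected_diagram D /\ ldigraph_iso T (intersection_graph D))
  <->
  (exists s : 'S_n, let T' := relabel T s in
    (* (1) *)
    (forall v w : T', adjacent v w ->
       exists i : 'I_n, i \in label v /\ i \in label w) /\
    (* (2) *)
    semisymmetric T' /\
    (* (3) *)
    (forall (v w : T') (i j k : 'I_n), i != j -> i != k -> j != k ->
       label v = [set i; j] -> label w = [set i; k] ->
       edge v w \/ edge w v) /\
    (* (4) *)
    (forall i j : 'I_n, (i.+1 < j) || (j.+1 < i) -> label_mult T' i j = 0) /\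
    (* (5), with colors shifted to 0, ..., n-1 *)
    ((forall i j : 'I_n, j = i.+1 :> nat -> 0 < i -> j < n.-1 ->
        label_mult T' i j = 1) /\
     (forall i j : 'I_n, i = 0 :> nat -> j = 1 :> nat ->
        1 <= label_mult T' i j) /\
     (forall i j : 'I_n, i = n - 2 :> nat -> j = n - 1 :> nat ->
        1 <= label_mult T' i j)) /\
    (* (6) *)
    (forall v w : T', v != w -> marked v -> marked w ->
       ~ connect (@undirected_edge n T') v w)).
Proof.
split.
  case=> d [D [conn_D T_D]]; have TP := iso_intersection_graph conn_D T_D.
  have [_ _ orient conn] := TP.
  have [s [dist consec]] :=
    relabel_color_path hT (corner_oriented_adjacent orient) conn.
  exists s => T'; have hT' : is_tree T' by exact: hT.
  have [share sym {}orient {}conn] := relabel_intersection_graph s TP.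
  have corner := corner_oriented_adjacent orient.
  split; first exact: share.
  split; first exact: sym.
  split.
    by move=> v w i j k ij ik jk vE wE; apply/orP; apply: corner vE wE.
  split.
    move=> i j ij; apply/eqP; rewrite cards_eq0; apply: contraTT ij.
    case/set0Pn=> v; rewrite inE => /eqP vE.
    have [->|neq] := eqVneq i j; first by rewrite ltnNge leqnSn.
    have cij : color_adjacent T' i j.
      by rewrite /color_adjacent neq; apply/existsP; exists v; apply/eqP.
    have cji : color_adjacent T' j i by rewrite color_adjacent_sym.
    by rewrite negb_or -!leqNgt !dist.
  split; last exact: marked_not_undirected_connected.
  split; last first.
    by split=> i j iE jE; apply: label_mult_gt0; apply: consec; lia.
  move=> i j ij i_gt0 jn; apply/eqP; rewrite eqn_leq label_mult_gt0 ?consec //.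
  (* The colors before [i] and after [j] exist because the pair is not at an end of the path; they
     supply the 4-cycle excluding a second vertex. *)
  have hP : i.-1 < n by lia.
  have kP : j.+1 < n by lia.
  rewrite andbT; apply: (@label_mult_le1 _ _ (Ordinal hP) i j (Ordinal kP)) => //.
  - by rewrite /= !inE !negb_or -!val_eqE /=; lia.
  - by apply: consec => /=; lia.
  - exact: consec.
case=> s [share [sym [edge3 [_ [[mid [first_ last_]] isolated]]]]].
have hT' : is_tree (relabel T s) by exact: hT.
have corner : corner_adjacent (relabel T s).
  by move=> v w i j k ij ik jk vE wE; apply/orP; apply: edge3 vE wE.
have conn : color_connected (relabel T s).
  apply: consecutive_color_connected => i j ij.
  have [i0|i_gt0] := posnP i; first by apply: first_; lia.
  have [jn|jn] := ltnP j n.-1; first by rewrite mid.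
  by apply: last_; have := ltn_ord j; lia.
(* Choose which end of each chord lies on which color of its label. *)
have [cmp cmpE] : exists cmp : relabel T s * bool -> 'I_n,
    forall v, label v = [set cmp (v, false); cmp (v, true)].
  have pairP (v : relabel T s) : exists p : 'I_n * 'I_n, label v == [set p.1; p.2].
    by have [i [j vE]] := labelP v; exists (i, j); apply/eqP.
  exists (fun e => let p := xchoose (pairP e.1) in if e.2 then p.2 else p.1).
  by move=> v; apply/eqP; apply: (xchooseP (pairP v)).
have [pos posP] := tree_realizable hn hT' share sym corner conn isolated cmpE.
have [irr _ _] := hT'.
have [D T_D] := realizes_diagram irr cmpE posP.
exists #|relabel T s|.
exact: unrelabel_diagram (iso_connected_diagram conn T_D) T_D.
Qed.
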